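(* The entailment problem of Two-Way Visibly-Pushdown Path Queries over $\mathcal{ALC}$-TBoxes is undecidable.
   Context: An $\mathcal{ALC}$-TBox is a finite set of general concept inclusions $C\sqsubseteq D$ between $\mathcal{ALC}$-concepts (built from $\top$, concept names, $\neg$, $\sqcap$, $\exists p.C$ for role names $p$); $\mathcal{I}$ is a model if $C^{\mathcal{I}}\subseteq D^{\mathcal{I}}$ for each inclusion. A Two-Way Visibly-Pushdown Path Query is a single atom $\mathcal{L}(x,y)$ where $\mathcal{L}$ is a visibly-pushdown language (given by a visibly-pushdown automaton) over a pushdown alphabet whose letters are role names $p$, inverse roles $p^-$, and tests $A?$ for concept names $A$, each letter assigned to be call, internal or return. $\mathcal{I}$ satisfies the query if there are elements $d,e$ and a sequence $d=\rho_1,\dots,\rho_{n+1}=e$ with a word $w_1\cdots w_n\in\mathcal{L}$ such that for each $i$: if $w_i=p$ then $(\rho_i,\rho_{i+1})\in p^{\mathcal{I}}$; if $w_i=p^-$ then $(\rho_{i+1},\rho_i)\in p^{\mathcal{I}}$; if $w_i=A?$ then $\rho_i=\rho_{i+1}\in A^{\mathcal{I}}$. A TBox entails a query if every model satisfies it; the problem asks, given $\mathcal{T}$ and $q$, whether $\mathcal{T}$ entails $q$. *)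

(* Defs.v *)
From HB Require Import structures.
From mathcomp Require Import all_boot.

Set Implicit Arguments.
Unset Strict Implicit.
Unset Printing Implicit Defensive.

Inductive concept : Type :=
| CTop
| CName of nat
| CNeg of concept
| CAnd of concept & concept
| CEx of nat & concept.

Fixpoint concept_enc (C : concept) : GenTree.tree nat :=
  match C with
  | CTop => GenTree.Node 0 [::]
  | CName A => GenTree.Node 1 [:: GenTree.Leaf A]
  | CNeg C1 => GenTree.Node 2 [:: concept_enc C1]
  | CAnd C1 C2 => GenTree.Node 3 [:: concept_enc C1; concept_enc C2]
  | CEx p C1 => GenTree.Node 4 [:: GenTree.Leaf p; concept_enc C1]
  end.
Fixpoint concept_dec (t : GenTree.tree nat) : option concept :=
  match t with
  | GenTree.Node 0 [::] => Some CTop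
  | GenTree.Node 1 [:: GenTree.Leaf A] => Some (CName A)
  | GenTree.Node 2 [:: t1] =>
      if concept_dec t1 is Some C1 then Some (CNeg C1) else None
  | GenTree.Node 3 [:: t1; t2] =>
      match concept_dec t1, concept_dec t2 with
      | Some C1, Some C2 => Some (CAnd C1 C2)
      | _, _ => None
      end
  | GenTree.Node 4 [:: GenTree.Leaf p; t1] =>
      if concept_dec t1 is Some C1 then Some (CEx p C1) else None
  | _ => None
  end.
Lemma concept_encK : pcancel concept_enc concept_dec.
Proof. by elim=> //= [C -> | C1 -> C2 -> | p C ->]. Qed.
HB.instance Definition _ := Countable.copy concept (pcan_type concept_encK).

(* A GCI  C ⊑ D  is the pair (C, D); a TBox is a finite list of GCIs. *)
Definition gci := (concept * concept)%type.
Definition tbox := seq gci.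

Record interp (D : Type) := Interp {
  cint : nat -> D -> Prop;
  rint : nat -> D -> D -> Prop
}.

Fixpoint cext (D : Type) (I : interp D) (C : concept) : D -> Prop :=
  match C with
  | CTop => fun _ => True
  | CName A => cint I A
  | CNeg C1 => fun x => ~ cext I C1 x
  | CAnd C1 C2 => fun x => cext I C1 x /\ cext I C2 x
  | CEx p C1 => fun x => exists y, rint I p x y /\ cext I C1 y
  end.

Definition is_model (D : Type) (I : interp D) (T : tbox) : Prop :=
  forall g, g \in T -> forall x, cext I g.1 x -> cext I g.2 x.

Inductive letter : Type :=
| LRole of nat
| LInv of nat
| LTest of nat.

Definition letter_enc (a : letter) : nat * nat :=
  match a with LRole p => (0, p) | LInv p => (1, p) | LTest A => (2, A) end.
Definition letter_dec (x : nat * nat) : letter :=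
  match x with (0, p) => LRole p | (1, p) => LInv p | (_, A) => LTest A end.
Lemma letter_encK : cancel letter_enc letter_dec.
Proof. by case. Qed.
HB.instance Definition _ := Countable.copy letter (can_type letter_encK).

Inductive ipath (D : Type) (I : interp D) : D -> seq letter -> D -> Prop :=
| ipath_nil d : ipath I d [::] d
| ipath_role d d' p w e :
    rint I p d d' -> ipath I d' w e -> ipath I d (LRole p :: w) e
| ipath_inv d d' p w e :
    rint I p d' d -> ipath I d' w e -> ipath I d (LInv p :: w) e
| ipath_test d A w e :
    cint I A d -> ipath I d w e -> ipath I d (LTest A :: w) e.

(* Visibly pushdown automata (Alur-Madhusudan), with states and stack   *)
(* symbols in nat.  The bottom-of-stack symbol is represented by None   *)
(* in return transitions / by the empty stack.  The pushdown alphabet   *)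
(* is Sigma_c (calls), Sigma_i (internal), Sigma_r (returns).           *)

Record vpa := VPA {
  v_init  : seq nat;
  v_final : seq nat;
  sig_c : seq letter;
  sig_i : seq letter;
  sig_r : seq letter;
  (* call: (q, a, q', gamma): read a, push gamma (gamma <> bottom) *)
  d_call : seq (nat * letter * nat * nat);
  d_int  : seq (nat * letter * nat);
  (* return: (q, a, Some gamma, q') pops gamma; (q, a, None, q') reads
     the bottom symbol on the empty stack without popping *)
  d_ret  : seq (nat * letter * option nat * nat)
}.





Definition vpa_enc (A : vpa) :=
  (v_init A, v_final A, sig_c A, sig_i A, sig_r A, d_call A, d_int A, d_ret A).
Definition vpa_dec x : vpa :=
  let: (a, b, c, d, e, f, g, h) := x in VPA a b c d e f g h.
Lemma vpa_encK : cancel vpa_enc vpa_dec.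
Proof. by case. Qed.
HB.instance Definition _ := Countable.copy vpa (can_type vpa_encK).

Definition vpa_wf (A : vpa) : Prop :=
  [/\ forall a, a \in sig_c A -> a \notin sig_i A,
      forall a, a \in sig_c A -> a \notin sig_r A &
      forall a, a \in sig_i A -> a \notin sig_r A] /\
  [/\ forall t, t \in d_call A -> t.1.1.2 \in sig_c A,
      forall t, t \in d_int A -> t.1.2 \in sig_i A &
      forall t, t \in d_ret A -> t.1.1.2 \in sig_r A].

Inductive vrun (A : vpa) : nat -> seq nat -> seq letter -> nat -> seq nat -> Prop :=
| vrun_nil q s : vrun A q s [::] q s
| vrun_call q a q' g s w q2 s2 :
    (q, a, q', g) \in d_call A -> vrun A q' (g :: s) w q2 s2 ->
    vrun A q s (a :: w) q2 s2
| vrun_int q a q' s w q2 s2 :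
    (q, a, q') \in d_int A -> vrun A q' s w q2 s2 ->
    vrun A q s (a :: w) q2 s2
| vrun_ret q a g q' s w q2 s2 :
    (q, a, Some g, q') \in d_ret A -> vrun A q' s w q2 s2 ->
    vrun A q (g :: s) (a :: w) q2 s2
| vrun_ret_bot q a q' w q2 s2 :
    (q, a, None, q') \in d_ret A -> vrun A q' [::] w q2 s2 ->
    vrun A q [::] (a :: w) q2 s2.

Definition vpa_lang (A : vpa) (w : seq letter) : Prop :=
  exists q0 qf s, [/\ q0 \in v_init A, qf \in v_final A & vrun A q0 [::] w qf s].

Definition satisfies_query (D : Type) (I : interp D) (A : vpa) : Prop :=
  exists d e w, vpa_lang A w /\ ipath I d w e.

Definition entails (T : tbox) (A : vpa) : Prop :=
  forall (D : Type) (I : interp D), inhabited D -> is_model I T -> satisfies_query I A.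

(* Model of computation: Minsky counter (register) machines.            *)

Inductive cinstr : Type :=
| CInc of nat
| CDec of nat & nat.

Definition cprog := seq cinstr.
Definition cconf := (nat * (nat -> nat))%type.

Definition cupd (f : nat -> nat) (r v : nat) : nat -> nat :=
  fun r' => if r' == r then v else f r'.

Definition cstep (P : cprog) (c : cconf) : cconf :=
  let: (pc, R) := c in
  if pc < size P then
    match nth (CInc 0) P pc with
    | CInc r => (pc.+1, cupd R r (R r).+1)
    | CDec r j => if R r == 0 then (j, R) else (pc.+1, cupd R r (R r).-1)
    end
  else c.

Definition cinit (n : nat) : cconf := (0, fun r => if r == 0 then n else 0).

Definition halts_with (P : cprog) (n m : nat) : Prop :=
  exists k, let c := iter k (cstep P) (cinit n) in size P <= c.1 /\ c.2 0 = m.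

Definition instance := (tbox * vpa)%type.

Definition entailment_decidable : Prop :=
  exists P : cprog, forall x : instance, vpa_wf x.2 ->
    (entails x.1 x.2 -> halts_with P (pickle x) 1) /\
    (~ entails x.1 x.2 -> halts_with P (pickle x) 0).

(* Main.v *)
(** A counter machine M on input n is simulated by a TBox T_n, depending on n
    only, and a query A_M, depending on M only.  T_n forces below every
    element a path 3 0^n 1 2 and an infinite path over the roles 0, 1, 2; such
    a path is read as a sequence of configurations, each being announced by 2
    and listing the state and the registers in unary (0^v 1).  The query looks
    for an error in this sequence, or for a halting state.  Its alphabet has
    tests that hold everywhere; being a call, a return or internal, they let
    the automaton push or pop a symbol while it reads a mark, and so compare
    a block with the corresponding block of the next configuration.  Then T_n
    entails A_M iff M halts on n.

    Given a decision procedure P, let M compute on input n the code of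
    (T_n, the query with code n), run P on it and halt iff P answers 0.  Since
    A_M does not depend on n, M can be run on the code of A_M. *)

From Stdlib Require Import Classical FunctionalExtensionality.
From HB Require Import structures.
Require Import Defs.
From mathcomp Require Import all_boot zify.

Set Implicit Arguments.
Unset Strict Implicit.
Unset Printing Implicit Defensive.

(** * Patterns and their acceptance with a stack height *)

(* [ABot] tests that the stack is empty. *)
Inductive act : Type := APush | APop | ABot | ASkip | AGo of nat.

Definition act_enc (a : act) : nat :=
  match a with APush => 0 | APop => 1 | ABot => 2 | ASkip => 3 | AGo e => e.+4 end.
Definition act_dec (n : nat) : act :=
  match n with 0 => APush | 1 => APop | 2 => ABot | 3 => ASkip | e.+4 => AGo e end.
Lemma act_encK : cancel act_enc act_dec.
Proof. by case. Qed.
HB.instance Definition _ := Countable.copy act (can_type act_encK).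

Definition act_letter (a : act) : letter :=
  match a with
  | APush => LTest 0 | APop => LTest 1 | ABot => LTest 1
  | ASkip => LTest 2 | AGo e => LRole e
  end.

(* The item [(b, E, a)] stands for the expression (b e)^* a, where e ranges
   over the roles in E. *)
Definition item := (act * seq nat * act)%type.
Definition pattern := seq item.

Section Acceptance.
Variables (D : Type) (I : interp D).

Definition astep (a : act) (h : nat) (x : D) (h' : nat) (y : D) : Prop :=
  match a with
  | APush => h' = h.+1 /\ y = x
  | APop => h = h'.+1 /\ y = x
  | ABot => [/\ h = 0, h' = 0 & y = x]
  | ASkip => h' = h /\ y = x
  | AGo e => h' = h /\ rint I e x y
  end.

(** One stack symbol suffices, so a stack is given by its height. The tests are left out, since they
    will hold everywhere, and the final stack is arbitrary. *)
Inductive acc : pattern -> nat -> D -> Prop :=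
| acc_nil h x : acc [::] h x
| acc_loop b E a p h x h1 x1 e x2 :
    astep b h x h1 x1 -> e \in E -> rint I e x1 x2 ->
    acc ((b, E, a) :: p) h1 x2 -> acc ((b, E, a) :: p) h x
| acc_exit b E a p h x h1 x1 :
    astep a h x h1 x1 -> acc p h1 x1 -> acc ((b, E, a) :: p) h x.

Lemma acc_consP b E a p h x :
  acc ((b, E, a) :: p) h x ->
  (exists h1 x1 e x2, [/\ astep b h x h1 x1, e \in E, rint I e x1 x2 &
                          acc ((b, E, a) :: p) h1 x2]) \/
  (exists h1 x1, astep a h x h1 x1 /\ acc p h1 x1).
Proof.
move Ep: ((b, E, a) :: p) => p' A.
case: A Ep => // [b' E' a' p2 h0 x0 h1 x1 e x2 st eE r A|b' E' a' p2 h0 x0 h1 x1 st A] [-> -> -> ->].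
- by left; exists h1, x1, e, x2.
- by right; exists h1, x1.
Qed.

Lemma acc_go b e p h x :
  acc ((b, [::], AGo e) :: p) h x -> exists2 y, rint I e x y & acc p h y.
Proof.
by case/acc_consP=> [[h1 [x1 [e' [x2 []]]]] //|[h1 [x1 [[-> r] A1]]]]; exists x1.
Qed.

End Acceptance.

Arguments acc_loop {D I b E a p h x h1 x1 e x2}.
Arguments acc_exit {D I b E a p h x h1 x1}.

(** * The visibly pushdown automaton of a list of patterns *)

Definition astate (f : bool) (p : pattern) : nat := pickle (f, p).

Lemma astate_inj f p f' p' : astate f p = astate f' p' -> (f, p) = (f', p').
Proof. exact: (pcan_inj pickleK). Qed.

(** A state consists of the pattern still to be read and a flag, set inside a loop between the
    action [b] and the role that follows it. *)
Definition edge := (bool * pattern * act * (bool * pattern))%type.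

Fixpoint pattern_edges (p : pattern) : seq edge :=
  if p is (b, E, a) :: q then
    [:: (false, p, b, (true, p)); (false, p, a, (false, q))]
      ++ [seq (true, p, AGo e, (false, p)) | e <- E] ++ pattern_edges q
  else [::].

Lemma pattern_edges_cons b E a q (p := (b, E, a) :: q) :
  pattern_edges p = [:: (false, p, b, (true, p)), (false, p, a, (false, q)) &
                       [seq (true, p, AGo e, (false, p)) | e <- E] ++ pattern_edges q].
Proof. by []. Qed.

Definition edges (Ps : seq pattern) : seq edge := flatten [seq pattern_edges p | p <- Ps].

Definition src (t : edge) : nat := astate t.1.1.1 t.1.1.2.
Definition tgt (t : edge) : nat := astate t.2.1 t.2.2.

Definition call_edges (t : edge) : seq (nat * letter * nat * nat) :=
  if t.1.2 is APush then [:: (src t, LTest 0, tgt t, 0)] else [::].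
Definition int_edges (t : edge) : seq (nat * letter * nat) :=
  match t.1.2 with
  | ASkip => [:: (src t, LTest 2, tgt t)]
  | AGo e => [:: (src t, LRole e, tgt t)]
  | _ => [::]
  end.
Definition ret_edges (t : edge) : seq (nat * letter * option nat * nat) :=
  match t.1.2 with
  | APop => [:: (src t, LTest 1, Some 0, tgt t)]
  | ABot => [:: (src t, LTest 1, None, tgt t)]
  | _ => [::]
  end.

Definition pattern_vpa (Ps : seq pattern) : vpa :=
  let dint := flatten [seq int_edges t | t <- edges Ps] in
  VPA [seq astate false p | p <- Ps] [:: astate false [::]]
      [:: LTest 0] [seq t.1.2 | t <- dint] [:: LTest 1]
      (flatten [seq call_edges t | t <- edges Ps])
      dint
      (flatten [seq ret_edges t | t <- edges Ps]).

(** The only call letter is [LTest 0] and the only return letter [LTest 1]; internal edges read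
    [LTest 2] or a role. *)
Lemma pattern_vpa_wf Ps : vpa_wf (pattern_vpa Ps).
Proof.
have int_letter a : a \in sig_i (pattern_vpa Ps) -> (a != LTest 0) && (a != LTest 1).
  case/mapP=> t /flattenP[s /mapP[u _ ->]] tu ->.
  move: tu; rewrite /int_edges; case: (u.1.2) => [||||e] //=; rewrite ?inE // => /eqP -> //.
split; split.
- move=> a; rewrite inE => /eqP ->; apply/negP => /int_letter; by rewrite eqxx.
- by move=> a; rewrite /= !inE => /eqP ->.
- by move=> a /int_letter /andP[_]; rewrite /= inE.
- move=> t /flattenP[s /mapP[u _ ->]]; rewrite /call_edges.
  by case: (u.1.2) => [||||e] //=; rewrite inE => /eqP ->; rewrite inE.
- by move=> t tin; apply/mapP; exists t.
- move=> t /flattenP[s /mapP[u _ ->]]; rewrite /ret_edges.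
  by case: (u.1.2) => [||||e] //=; rewrite inE => /eqP ->; rewrite inE.
Qed.

Section PatternVpa.
Variables (D : Type) (I : interp D) (Ps : seq pattern).

Definition loop_roles (p : pattern) : seq nat := if p is (_, E, _) :: _ then E else [::].

Definition state_acc (f : bool) (p : pattern) (h : nat) (x : D) : Prop :=
  if f then exists e y, [/\ e \in loop_roles p, rint I e x y & acc I p h y]
  else acc I p h x.

Lemma edge_acc f p a f' p' h x h1 x1 :
  (f, p, a, (f', p')) \in edges Ps -> astep I a h x h1 x1 ->
  state_acc f' p' h1 x1 -> state_acc f p h x.
Proof.
case/flattenP=> s /mapP[q _ ->]; elim: q => [//|[[b E] c] q IH] /=.
rewrite !inE mem_cat => /or4P[/eqP[-> -> -> -> ->]|/eqP[-> -> -> -> ->]|/mapP[e eE [-> -> -> -> ->]]|/IH //] st.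
- by move=> [e [y [eE r A]]]; apply: (acc_loop st eE r A).
- exact: acc_exit st.
- by case: st => -> r A; exists e, x1.
Qed.

(** Every call pushes 0, so the stack stays of the form [nseq h 0]. The tests are simply dropped;
    this direction holds in any interpretation. *)
Lemma vrun_acc q s w q2 s2 : vrun (pattern_vpa Ps) q s w q2 s2 ->
  forall f p h x e, q = astate f p -> s = nseq h 0 -> q2 = astate false [::] ->
  ipath I x w e -> state_acc f p h x.
Proof.
elim=> {q s w q2 s2}.
- move=> q s f p h x e -> _ /astate_inj[-> ->] _; exact: acc_nil.
- move=> q a q' g s w q2 s2 /flattenP[s' /mapP[t tin ->]].
  case: t tin => [[[f0 p0] a0] [f1 p1]] /= tin.
  rewrite /call_edges /=; case: a0 tin => //= tin.
  rewrite inE => /eqP[-> -> -> ->] _ IH f p h x e /astate_inj[<- <-] sh qf ip.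
  inversion ip; subst.
  by apply: (edge_acc (h1 := h.+1) (x1 := x) tin) => //; apply: (IH f1 p1 h.+1 x e).
- move=> q a q' s w q2 s2 /flattenP[s' /mapP[t tin ->]].
  case: t tin => [[[f0 p0] a0] [f1 p1]] /= tin.
  rewrite /int_edges /=; case: a0 tin => [||||r] //= tin;
  rewrite inE => /eqP[-> -> ->] _ IH f p h x e /astate_inj[<- <-] sh qf ip;
  inversion ip; subst.
  + by apply: (edge_acc (h1 := h) (x1 := x) tin) => //; apply: (IH f1 p1 h x e).
  + by apply: (edge_acc (h1 := h) (x1 := d') tin) => //; apply: (IH f1 p1 h d' e).
- move=> q a g q' s w q2 s2 /flattenP[s' /mapP[t tin ->]].
  case: t tin => [[[f0 p0] a0] [f1 p1]] /= tin.
  rewrite /ret_edges /=; case: a0 tin => [||||r] //= tin;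
  rewrite inE => /eqP[] // -> -> -> -> _ IH f p h x e /astate_inj[<- <-] sh qf ip.
  inversion ip; subst; case: h sh => // h [sh].
  by apply: (edge_acc (h1 := h) (x1 := x) tin) => //; apply: (IH f1 p1 h x e).
- move=> q a q' w q2 s2 /flattenP[s' /mapP[t tin ->]].
  case: t tin => [[[f0 p0] a0] [f1 p1]] /= tin.
  rewrite /ret_edges /=; case: a0 tin => [||||r] //= tin;
  rewrite inE => /eqP[] // -> -> -> _ IH f p h x e /astate_inj[<- <-] sh qf ip.
  inversion ip; subst; case: h sh => // _.
  by apply: (edge_acc (h1 := 0) (x1 := x) tin) => //; apply: (IH f1 p1 0 x e).
Qed.

Lemma satisfies_acc : satisfies_query I (pattern_vpa Ps) ->
  exists2 p, p \in Ps & exists x, acc I p 0 x.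
Proof.
move=> [d [e [w [[q0 [qf [s [/mapP[p pin ->]]]]]]]]].
rewrite inE => /eqP -> run ip; exists p => //; exists d.
exact: (vrun_acc run (f := false) (h := 0) _ _ _ ip).
Qed.

Hypothesis tests : forall A x, A < 3 -> cint I A x.

Definition runs_from (q : nat) (s : seq nat) (x : D) : Prop :=
  exists w s2 e, vrun (pattern_vpa Ps) q s w (astate false [::]) s2 /\ ipath I x w e.

(** Conversely, the tests read by pushes, pops and skips have to succeed, which [tests] provides. *)
Lemma edge_runs f p a f' p' h x h1 x1 :
  (f, p, a, (f', p')) \in edges Ps -> astep I a h x h1 x1 ->
  runs_from (astate f' p') (nseq h1 0) x1 -> runs_from (astate f p) (nseq h 0) x.
Proof.
move=> tin st [w [s2 [e [run ip]]]]; exists (act_letter a :: w), s2, e.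
case: a tin st => [||||r] tin; rewrite /astep /act_letter.
- case=> ? ?; subst; split; last by apply: ipath_test => //; apply: tests.
  apply: vrun_call run; apply/flattenP; exists (call_edges (f, p, APush, (f', p'))).
    by apply/mapP; eexists; first exact: tin.
  by rewrite inE.
- case=> ? ?; subst; split; last by apply: ipath_test => //; apply: tests.
  apply: vrun_ret run; apply/flattenP; exists (ret_edges (f, p, APop, (f', p'))).
    by apply/mapP; eexists; first exact: tin.
  by rewrite inE.
- case=> ? ? ?; subst; split; last by apply: ipath_test => //; apply: tests.
  apply: vrun_ret_bot run; apply/flattenP; exists (ret_edges (f, p, ABot, (f', p'))).
    by apply/mapP; eexists; first exact: tin.
  by rewrite inE.
- case=> ? ?; subst; split; last by apply: ipath_test => //; apply: tests.
  apply: vrun_int run; apply/flattenP; exists (int_edges (f, p, ASkip, (f', p'))).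
    by apply/mapP; eexists; first exact: tin.
  by rewrite inE.
- case=> ? rr; subst; split; last exact: ipath_role rr ip.
  apply: vrun_int run; apply/flattenP; exists (int_edges (f, p, AGo r, (f', p'))).
    by apply/mapP; eexists; first exact: tin.
  by rewrite inE.
Qed.

Lemma acc_runs p h x : acc I p h x -> {subset pattern_edges p <= edges Ps} ->
  runs_from (astate false p) (nseq h 0) x.
Proof.
elim=> {p h x}.
- move=> h x _; exists [::], (nseq h 0), x; split; [exact: vrun_nil | exact: ipath_nil].
- move=> b E a p h x h1 x1 e x2 st eE r _ IH sub.
  apply: (edge_runs (f' := true) _ st); first by apply: sub; apply: mem_head.
  apply: (edge_runs (a := AGo e) (f' := false) (h1 := h1) (x1 := x2)) (IH sub) => //.
  by apply: sub; rewrite pattern_edges_cons !in_cons mem_cat map_f ?orbT.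
- move=> b E a p h x h1 x1 st _ IH sub.
  apply: (edge_runs (f' := false) (p' := p) _ st); first by apply: sub; rewrite pattern_edges_cons in_cons mem_head orbT.
  by apply: IH => t tin; apply: sub; rewrite pattern_edges_cons !in_cons mem_cat tin !orbT.
Qed.

Lemma acc_satisfies p x : p \in Ps -> acc I p 0 x -> satisfies_query I (pattern_vpa Ps).
Proof.
move=> pin A.
have sub : {subset pattern_edges p <= edges Ps}.
  by move=> t tin; apply/flattenP; exists (pattern_edges p) => //; apply: map_f.
have [w [s2 [e [run ip]]]] := acc_runs A sub.
exists x, e, w; split=> //; exists (astate false p), (astate false [::]), s2.
by split; [apply: map_f | apply: mem_head | ].
Qed.

End PatternVpa.

(** * Configurations as blocks of marks *)

(* A block spec [(g, l, k)] pushes [k] symbols, reads [g] marks, then the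
   remaining ones: none if [l = None], and pushing a symbol for each of
   them if [l = Some true]. *)
Definition spec := (nat * option bool * nat)%type.

Definition spec_pattern (s : spec) : pattern :=
  let: (g, l, k) := s in
  nseq k (ASkip, [::], APush) ++ nseq g (ASkip, [::], AGo 0) ++
  [:: match l with
      | None => (ASkip, [::], AGo 1)
      | Some b => (if b then APush else ASkip, [:: 0], AGo 1)
      end].

Definition specs_pattern (ss : seq spec) : pattern := flatten [seq spec_pattern s | s <- ss].

(** Here [m] is the height gained by reading a block of [v] marks. *)
Definition fit (s : spec) (v m : nat) : Prop :=
  let: (g, l, k) := s in
  match l with
  | None => v = g /\ m = k
  | Some b => g <= v /\ m = k + (if b then v - g else 0)
  end.

Fixpoint fits (ss : seq spec) (vs : seq nat) (m : nat) : Prop :=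
  match ss, vs with
  | [::], [::] => m = 0
  | s :: ss', v :: vs' => exists m1 m2, [/\ m = m1 + m2, fit s v m1 & fits ss' vs' m2]
  | _, _ => False
  end.

Definition skip_spec : spec := (0, Some false, 0).

Lemma fits_skip vs : fits (nseq (size vs) skip_spec) vs 0.
Proof. by elim: vs => //= v vs IH; exists 0, 0. Qed.

Lemma fits_skipE t vs m : fits (nseq t skip_spec) vs m -> m = 0.
Proof.
elim: t vs m => [|t IH] [|v vs] m //= [m1 [m2 [-> [_ ->] /IH ->]]] //.
Qed.

Lemma fits_map (f : nat -> spec) (g mu : nat -> nat) (l : seq nat) :
  (forall b, b \in l -> fit (f b) (g b) (mu b)) ->
  fits [seq f b | b <- l] [seq g b | b <- l] (\sum_(b <- l) mu b).
Proof.
elim: l => [|b l IH] F /=; first by rewrite big_nil.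
exists (mu b), (\sum_(b <- l) mu b); split; first by rewrite big_cons.
- by apply: F; rewrite mem_head.
- by apply: IH => c cl; apply: F; rewrite in_cons cl orbT.
Qed.

(** Once each block determines its contribution [mu], the total height is determined; this recovers
    the height from an accepting run. *)
Lemma fits_mapE (f : nat -> spec) (g : nat -> nat) (l : seq nat) m :
  fits [seq f b | b <- l] [seq g b | b <- l] m ->
  (forall b, b \in l -> exists m', fit (f b) (g b) m') /\
  (forall mu : nat -> nat, (forall b m', b \in l -> fit (f b) (g b) m' -> m' = mu b) ->
     m = \sum_(b <- l) mu b).
Proof.
elim: l m => [|b l IH] m /=; first by move=> ->; split=> // mu _; rewrite big_nil.
move=> [m1 [m2 [-> F1 /IH[Ex Un]]]]; split.
- by move=> c; rewrite in_cons => /predU1P[->|/Ex //]; exists m1.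
- move=> mu H; rewrite big_cons (H b m1) ?mem_head // (Un mu) // => c m' cl.
  by apply: H; rewrite in_cons cl orbT.
Qed.

Section Reading.
Variables (D : Type) (I : interp D).

Fixpoint marks (v : nat) (x y : D) : Prop :=
  if v is v'.+1 then exists2 z, rint I 0 x z & marks v' z y else x = y.

Fixpoint reads (vs : seq nat) (x y : D) : Prop :=
  if vs is v :: vs' then exists z z', [/\ marks v x z, rint I 1 z z' & reads vs' z' y]
  else x = y.

Lemma marks_add g v x y : marks (g + v) x y -> exists2 z, marks g x z & marks v z y.
Proof.
elim: g x => [|g IH] x /=; first by exists x.
by move=> [z r /IH[u mu mv]]; exists u => //; exists z.
Qed.

Lemma reads_rcons vs v x y z z' : reads vs x y -> marks v y z -> rint I 1 z z' ->
  reads (rcons vs v) x z'.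
Proof.
elim: vs x => [|u vs IH] x /=; first by move=> -> mz r; exists z, z'.
by move=> [a [b [ma r /IH rb mz r']]]; exists a, b; split=> //; apply: rb.
Qed.

Lemma acc_pushes k q h x : acc I q (h + k) x -> acc I (nseq k (ASkip, [::], APush) ++ q) h x.
Proof.
elim: k h => [|k IH] h; first by rewrite addn0.
by rewrite addnS => A; apply: (acc_exit (h1 := h.+1) (x1 := x)) => //; apply: IH.
Qed.

Lemma acc_marks g q h x z : marks g x z -> acc I q h z ->
  acc I (nseq g (ASkip, [::], AGo 0) ++ q) h x.
Proof.
elim: g x => [|g IH] x /=; first by move=> ->.
by move=> [u r /IH mz /mz]; apply: acc_exit.
Qed.

Lemma acc_loop_marks (b : bool) a q v h x z : marks v x z ->
  acc I ((if b then APush else ASkip, [:: 0], a) :: q) (h + (if b then v else 0)) z ->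
  acc I ((if b then APush else ASkip, [:: 0], a) :: q) h x.
Proof.
elim: v h x => [|v IH] h x /=; first by move=> ->; rewrite if_same addn0.
move=> [u r mz] A.
case: b IH mz A => IH mz A.
- apply: (acc_loop (h1 := h.+1) (x1 := x) _ _ r) => //.
  by apply: IH mz _; rewrite addSn -addnS.
- by apply: (acc_loop (h1 := h) (x1 := x) _ _ r) => //; apply: IH mz A.
Qed.

Lemma acc_spec s v m q h x z y : fit s v m -> marks v x z -> rint I 1 z y ->
  acc I q (h + m) y -> acc I (spec_pattern s ++ q) h x.
Proof.
case: s => [[g [b|]] k] /=.
- case=> gv -> mz r A; rewrite -!catA; apply: acc_pushes.
  move: mz; rewrite -(subnKC gv) => /marks_add[u mu mz].
  apply: acc_marks mu _; apply: acc_loop_marks mz _.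
  by apply: (acc_exit (h1 := h + k + (if b then v - g else 0)) (x1 := y)) => //; rewrite -addnA.
- case=> -> -> mz r A; rewrite -!catA; apply: acc_pushes.
  by apply: acc_marks mz _; apply: acc_exit A.
Qed.

Lemma acc_specs ss vs m q h x y : fits ss vs m -> reads vs x y ->
  acc I q (h + m) y -> acc I (specs_pattern ss ++ q) h x.
Proof.
elim: ss vs m h x => [|s ss IH] [|v vs] m h x //=.
- by move=> -> ->; rewrite addn0.
- move=> [m1 [m2 [-> F Fs]]] [z [z' [mz r rd]]] A.
  rewrite /specs_pattern /= -catA; apply: acc_spec F mz r _.
  by apply: IH Fs rd _; rewrite -addnA.
Qed.

End Reading.

(* Run with a stack of height [v] at the start of a block, these detect
   respectively that the block has less than [v] marks, that it has more,
   and that it is not closed by role 1. *)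
Definition mismatches : seq pattern :=
  [:: [:: (APop, [:: 0], APop); (ASkip, [::], AGo 1)];
      [:: (APop, [:: 0], ABot); (ASkip, [::], AGo 0)];
      [:: (ASkip, [:: 0], AGo 2)]].

Section Blocks.
Variables (D : Type) (I : interp D).
Hypothesis total : forall x, exists2 e, e < 3 & exists y, rint I e x y.

(** By [total], one of the roles 0, 1, 2 can be followed from each element. The induction follows
    role 0 and lowers the height; the third pattern never pops, so its alternative must be kept for
    all heights. *)
Lemma block_exists v x :
  [\/ exists2 p, p \in take 2 mismatches & acc I p v x,
      forall h, acc I (nth [::] mismatches 2) h x |
      exists z y, marks I v x z /\ rint I 1 z y].
Proof.
elim: v x => [|v IH] x; have [[|[|[|//]]] _ [y r]] := total x.
- constructor 1; exists (nth [::] mismatches 1) => //.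
  apply: (acc_exit (h1 := 0) (x1 := x)) => //.
  by apply: (acc_exit (h1 := 0) (x1 := y)) => //; apply: acc_nil.
- by constructor 3; exists x, y.
- constructor 2 => h.
  by apply: (acc_exit (h1 := h) (x1 := y)) => //; apply: acc_nil.
- have [[p pin A]|A|[z [y' [mz r']]]] := IH y.
  + constructor 1; exists p => //; move: pin A; rewrite !inE => /orP[] /eqP -> A.
    * by apply: (acc_loop (h1 := v) (x1 := x) _ _ r A).
    * by apply: (acc_loop (h1 := v) (x1 := x) _ _ r A).
  + by constructor 2 => h; apply: (acc_loop (h1 := h) (x1 := x) _ _ r (A h)).
  + by constructor 3; exists z, y'; split=> //; exists y.
- constructor 1; exists (nth [::] mismatches 0) => //.
  apply: (acc_exit (h1 := v) (x1 := x)) => //.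
  by apply: (acc_exit (h1 := v) (x1 := y)) => //; apply: acc_nil.
- constructor 2 => h.
  by apply: (acc_exit (h1 := h) (x1 := y)) => //; apply: acc_nil.
Qed.

(** The first block that cannot be read as prescribed is [t']; those before it are skipped with the
    stack unchanged. *)
Lemma blocks_exist vs x t : t <= size vs ->
  (exists t' p, [/\ t' < t, p \in mismatches &
      acc I (specs_pattern (nseq t' skip_spec) ++ p) (nth 0 vs t') x]) \/
  (exists y, reads I (take t vs) x y).
Proof.
elim: t => [_|t IH tvs]; first by right; exists x; rewrite take0.
have [[t' [p [lt pin A]]]|[y rd]] := IH (ltnW tvs).
  by left; exists t', p; split=> //; apply: ltnW.
have F : fits (nseq t skip_spec) (take t vs) 0.
  by have := fits_skip (take t vs); rewrite size_takel // ltnW.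
have [[p pin A]|A|[z [y' [mz r]]]] := block_exists (nth 0 vs t) y.
- left; exists t, p; split=> //; first exact: mem_take pin.
  by apply: acc_specs F rd _; rewrite addn0.
- left; exists t, (nth [::] mismatches 2); split=> //.
  by apply: acc_specs F rd _; rewrite addn0.
- by right; exists y'; rewrite (take_nth 0) //; apply: reads_rcons mz r.
Qed.

End Blocks.

(** * The interpretation that unfolds a run *)

(* The unfolding of a run: an element is the index of the next
   configuration together with the blocks still to be read. *)
Section Unfolding.
Variables (n : nat) (c : nat -> seq nat).

Definition unfolding : interp (nat * seq nat) := {|
  cint := fun _ _ => True;
  rint := fun e x y =>
    match e, x with
    | 0, (i, v.+1 :: s) => y = (i, v :: s)
    | 1, (i, 0 :: s) => y = (i, s)
    | 2, (i, [::]) => y = (i.+1, c i)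
    | 3, _ => y = (0, [:: n])
    | _, _ => False
    end |}.

Local Notation I := unfolding.

(** Exactly one of the roles 0, 1, 2 leaves each element of the unfolding, to a single successor, so
    the reading lemmas can be inverted. *)
Lemma unfolding_pushes k q h x :
  acc I (nseq k (ASkip, [::], APush) ++ q) h x -> acc I q (h + k) x.
Proof.
elim: k h => [|k IH] h /=; first by rewrite addn0.
by move=> A; case: (acc_consP A) => {A} [[? [? [? [? []]]]] //|[h1 [x1 [[-> ->] /IH]]]]; rewrite addSnnS.
Qed.

Lemma unfolding_marks g q h i v s :
  acc I (nseq g (ASkip, [::], AGo 0) ++ q) h (i, v :: s) ->
  g <= v /\ acc I q h (i, v - g :: s).
Proof.
elim: g v => [|g IH] v /=; first by rewrite subn0.
by move=> A; case: (acc_go A) => {A} y; case: v => [//|v] -> /IH[]; rewrite subSS.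
Qed.

(** Role 1 is available only when no mark is left, so the loop cannot stop early. *)
Lemma unfolding_loop (b : bool) q h i v s :
  acc I ((if b then APush else ASkip, [:: 0], AGo 1) :: q) h (i, v :: s) ->
  acc I q (h + (if b then v else 0)) (i, s).
Proof.
elim: v h => [|v IH] h.
- move=> A; case: (acc_consP A) => {A} [[h1 [x1 [e [x2 [st]]]]]|[h1 [x1 [[-> /= ->]]]]].
  + by rewrite inE => /eqP ->; case: b st => -[_ ->].
  + by rewrite if_same addn0.
- move=> A; case: (acc_consP A) => {A} [[h1 [x1 [e [x2 [st]]]]]|[h1 [x1 [[_ []]]]]].
  rewrite inE => /eqP ->; case: b st IH => -[-> ->] /= IH -> /IH; last by rewrite !addn0.
  by rewrite addSnnS.
Qed.

Lemma unfolding_spec s q h i v vs : acc I (spec_pattern s ++ q) h (i, v :: vs) ->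
  exists2 m, fit s v m & acc I q (h + m) (i, vs).
Proof.
case: s => [[g l] k]; rewrite /spec_pattern -!catA => /unfolding_pushes /unfolding_marks[gv].
case: l => [b|] /=.
- move/unfolding_loop; rewrite -addnA; exists (k + (if b then v - g else 0)) => //.
- move=> A; case: (acc_go A) => {A} y; case E: (v - g) => [|//] -> A; exists k => //; split=> //.
  by apply/eqP; rewrite eqn_leq gv -subn_eq0 E.
Qed.

Lemma unfolding_specs ss q h i vs : size ss <= size vs ->
  acc I (specs_pattern ss ++ q) h (i, vs) ->
  exists2 m, fits ss (take (size ss) vs) m & acc I q (h + m) (i, drop (size ss) vs).
Proof.
elim: ss vs h => [|s ss IH] [|v vs] h //= sz.
- by exists 0; rewrite // addn0.
- by exists 0; rewrite // addn0.
- rewrite /specs_pattern /= -catA => /unfolding_spec[m1 F1 /(IH _ _ sz)[m2 F2 A]].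
  by exists (m1 + m2); rewrite ?addnA //; exists m1, m2.
Qed.

Lemma unfolding_mismatch p v i vs : p \in mismatches -> ~ acc I p v (i, v :: vs).
Proof.
rewrite !inE => /or3P[] /eqP -> {p}.
- elim: v => [|v IH]; move=> A; case: (acc_consP A) => {A} [[h1 [x1 [e [x2 [[E1 ->]]]]]]|[h1 [x1 [[E1 ->]]]]].
  + by [].
  + by [].
  + rewrite inE => /eqP -> /= ->; case: E1 => <-; exact: IH.
  + by move=> A; case: (acc_go A).
- elim: v => [|v IH]; move=> A; case: (acc_consP A) => {A} [[h1 [x1 [e [x2 [[E1 ->]]]]]]|[h1 [x1 []]]].
  + by [].
  + by case=> _ _ -> A; case: (acc_go A).
  + rewrite inE => /eqP -> /= ->; case: E1 => <-; exact: IH.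
  + by case.
(* The third pattern leaves the stack alone, so the height is separated from the length of the block
   before the induction. *)
- move: {1}v => h; elim: v h => [|v IH] h; move=> A; case: (acc_consP A) => {A} [[h1 [x1 [e [x2 [[-> ->]]]]]]|[h1 [x1 [[]]]]] //.
  + by rewrite inE => /eqP ->.
  + by rewrite inE => /eqP -> /= -> /IH.
Qed.

(** Wherever the loop leads, a role 2 always opens a configuration. *)
Lemma unfolding_any q h x : acc I ((ASkip, [:: 0; 1; 2], AGo 2) :: q) h x ->
  exists i, acc I q h (i.+1, c i).
Proof.
move E: (_ :: q) => p A; elim: A E => // {p h x}.
- by move=> b E a p h x h1 x1 e x2 st _ _ A IH [? ? ? ?]; subst; case: st => ? ?; subst; apply: IH.
- move=> b E a p h x h1 x1 st A _ [? ? ? ?]; subst; move: st A => [-> /=].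
  by case: x => [i [|? ?]] // -> A; exists i.
Qed.

End Unfolding.

(** * Counter machines *)

(* The transition [(q, q', r, g, z, d)] applies in state [q] if register [r]
   is at least [g] (exactly [g] when [z] holds); it goes to state [q'] and
   replaces the content [v] of register [r] by [v - g + d]. *)
Definition transition := (nat * nat * nat * nat * bool * nat)%type.

Definition applies (t : transition) (x : cconf) : Prop :=
  let: (q, q', r, g, z, d) := t in [/\ x.1 = q, g <= x.2 r & z -> x.2 r = g].

Definition leads (t : transition) (x y : cconf) : Prop :=
  let: (q, q', r, g, z, d) := t in
  y.1 = q' /\ forall b, y.2 b = if b == r then x.2 r - g + d else x.2 b.

Definition treg (t : transition) : nat := let: (q, q', r, g, z, d) := t in r.

Definition transitions (M : cprog) (q : nat) : seq transition :=
  match nth (CInc 0) M q with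
  | CInc r => [:: (q, q.+1, r, 0, false, 1)]
  | CDec r j => [:: (q, j, r, 0, true, 0); (q, q.+1, r, 1, false, 0)]
  end.

Lemma transitions_sound M q t x : q < size M -> t \in transitions M q ->
  applies t x -> leads t x (cstep M x).
Proof.
case: x => pc R qM; rewrite /transitions.
case E: (nth _ _ _) => [r|r j]; rewrite !inE.
- by move/eqP=> -> [/= -> _ _]; rewrite qM E /= subn0 addn1.
- case/orP=> /eqP -> [/= ->]; rewrite qM E.
  + move=> _ /(_ isT) R0; rewrite R0 /=; split=> // b; case: eqP => // ->; exact: R0.
  + by rewrite lt0n => /negPf -> _; rewrite /= subn1 addn0.
Qed.

Lemma transitions_complete M x : x.1 < size M -> exists2 t, t \in transitions M x.1 & applies t x.
Proof.
case: x => pc R /= pM; rewrite /transitions.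
case: (nth _ _ _) => [r|r j].
- by exists (pc, pc.+1, r, 0, false, 1); rewrite ?inE ?eqxx ?orbT //.
- have [R0|R0] := posnP (R r).
  + by exists (pc, j, r, 0, true, 0); rewrite ?inE ?eqxx ?orbT //.
  + by exists (pc, pc.+1, r, 1, false, 0); rewrite ?inE ?eqxx ?orbT //.
Qed.

Definition creg (i : cinstr) : nat := match i with CInc r => r | CDec r _ => r end.

(** It is positive, so register 0, which holds the input, always has a block. *)
Definition width (M : cprog) : nat := (\max_(i <- M) creg i).+1.

Lemma treg_width M q t : q < size M -> t \in transitions M q -> treg t < width M.
Proof.
move=> qM; have: creg (nth (CInc 0) M q) < width M.
  rewrite ltnS (big_nth (CInc 0)).
  by apply: (leq_bigmax_seq (F := fun i : nat => creg (nth (CInc 0) M i))); rewrite ?mem_index_iota.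
rewrite /transitions; case: (nth _ _ _) => [r|r j] rw; rewrite !inE; first by move/eqP ->.
by case/orP=> /eqP ->.
Qed.

Definition blocks (K : nat) (x : cconf) : seq nat := x.1 :: [seq x.2 b | b <- iota 0 K].

Lemma size_blocks K x : size (blocks K x) = K.+1.
Proof. by rewrite /= size_map size_iota. Qed.

Lemma nth_blocksS K x i : i < K -> nth 0 (blocks K x) i.+1 = x.2 i.
Proof. by move=> iK; rewrite /= (nth_map 0) ?size_iota // nth_iota. Qed.

(** Written as a sum over all blocks, because the automaton accumulates its pushes while it reads a
    whole configuration. *)
Lemma nth_blocks K x i : i <= K ->
  nth 0 (blocks K x) i =
  (if i == 0 then x.1 else 0) + \sum_(b <- iota 0 K) (if i == b.+1 then x.2 b else 0).
Proof.
case: i => [|i] iK; first by rewrite big1_seq ?addn0.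
rewrite nth_blocksS // add0n.
rewrite (bigD1_seq i) ?mem_iota ?iota_uniq //= eqxx big1_seq ?addn0 //.
by move=> b /andP[/negPf bi _]; rewrite eqSS eq_sym bi.
Qed.

(* Reading a configuration through these specs pushes the [i]-th block of
   its successor by [t]. *)
Definition reg_spec (t : transition) (i b : nat) : spec :=
  let: (q, q', r, g, z, d) := t in
  if b == r then (g, if z then None else Some (i == b.+1), if i == b.+1 then d else 0)
  else (0, Some (i == b.+1), 0).

Definition state_spec (t : transition) (i : nat) : spec :=
  let: (q, q', r, g, z, d) := t in (q, None, if i == 0 then q' else 0).

Definition transition_specs (K : nat) (t : transition) (i : nat) : seq spec :=
  state_spec t i :: [seq reg_spec t i b | b <- iota 0 K].

Lemma fits_transition K t i x y : i <= K -> applies t x -> leads t x y ->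
  fits (transition_specs K t i) (blocks K x) (nth 0 (blocks K y) i).
Proof.
case: t => [[[[[q q'] r] g] z] d] iK [xq gx zx] [yq yE].
eexists _, _; split; first exact: nth_blocks.
  by rewrite /= xq yq.
apply: fits_map => b _ /=; case: eqP => [->|br] /=.
- case: z zx => [/(_ isT) xg|_]; rewrite yE ?eqxx.
  + by rewrite xg subnn.
  + by split=> //; case: ifP => // _; rewrite addnC.
- by split=> //; rewrite yE; move/eqP/negPf: br => ->; rewrite subn0.
Qed.

(** Reading the configuration checks the guard: the state block must have exactly the marks of the
    source state, and the block of register [treg t], present because [treg t < K], is tested
    against [g] and [z]. *)
Lemma fits_transitionE K t i x y m : treg t < K -> i <= K ->
  fits (transition_specs K t i) (blocks K x) m ->
  applies t x /\ (leads t x y -> m = nth 0 (blocks K y) i).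
Proof.
rewrite /treg; case: t => [[[[[q q'] r] g] z] d] rK iK [m1 [m2 [-> [xq m1E] /fits_mapE[ex un]]]].
have rin : r \in iota 0 K by rewrite mem_iota.
have ap : applies (q, q', r, g, z, d) x.
  by have [m'] := ex r rin; rewrite /= eqxx; case: z {ex un} => [] [H] _; split=> //; rewrite H.
split=> // -[yq yE]; rewrite nth_blocks // m1E yq; congr (_ + _); apply: un => b m' _ /=.
case: eqP => [->|br] /=.
- case: z ap {ex} => [] [_ gx zx]; rewrite yE eqxx => -[_ ->].
  + by rewrite zx // subnn.
  + by case: ifP => // _; rewrite addnC.
- by case=> _ ->; rewrite yE; move/eqP/negPf: br => ->; rewrite subn0.
Qed.

(** * The query and the TBox of a machine *)

Definition enter : item := (ASkip, [::], AGo 3).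
Definition next : item := (ASkip, [::], AGo 2).
Definition anywhere : item := (ASkip, [:: 0; 1; 2], AGo 2).

(** The input is the initial content of register 0, hence block 1; all other initial blocks are
    empty and nothing is pushed for them. *)
Definition input_spec (i : nat) : spec := (0, Some (i == 1), 0).

Definition target_pattern (i : nat) (p : pattern) : pattern :=
  next :: specs_pattern (nseq i skip_spec) ++ p.

Definition input_patterns (K : nat) : seq pattern :=
  [seq enter :: spec_pattern (input_spec i) ++ target_pattern i p
     | i <- iota 0 K.+1, p <- mismatches].

Definition step_patterns (M : cprog) : seq pattern :=
  [seq enter :: anywhere :: specs_pattern (transition_specs (width M) ti.1 ti.2)
       ++ target_pattern ti.2 p
     | ti <- [seq (t, i) | t <- flatten [seq transitions M q | q <- iota 0 (size M)],
                           i <- iota 0 (width M).+1],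
       p <- mismatches].

(** The error here is a role 0 or 1 after the state and the [K] registers, where role 2 is due. *)
Definition end_patterns (K : nat) : seq pattern :=
  [seq enter :: anywhere :: specs_pattern (nseq K.+1 skip_spec) ++ [:: (ASkip, [::], AGo e)]
     | e <- [:: 0; 1]].

(** A state is halting when its block has at least [size M] marks. *)
Definition halt_pattern (M : cprog) : pattern :=
  enter :: anywhere :: nseq (size M) (ASkip, [::], AGo 0).

Definition machine_patterns (M : cprog) : seq pattern :=
  halt_pattern M :: end_patterns (width M) ++ input_patterns (width M) ++ step_patterns M.

Lemma mem_machine_patterns M p :
  (p \in machine_patterns M) =
  [|| p == halt_pattern M, p \in end_patterns (width M),
      p \in input_patterns (width M) | p \in step_patterns M].
Proof.
rewrite /machine_patterns; move: (end_patterns _) (input_patterns _) (step_patterns _) => *.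
by rewrite in_cons !mem_cat.
Qed.

Definition machine_vpa (M : cprog) : vpa := pattern_vpa (machine_patterns M).

Definition chain (n : nat) : concept := iter n (CEx 0) (CEx 1 (CEx 2 CTop)).

(** The disjunction of the three existential concepts over roles 0, 1, 2, by De Morgan. *)
Definition progress : concept :=
  CNeg (CAnd (CNeg (CEx 0 CTop)) (CAnd (CNeg (CEx 1 CTop)) (CNeg (CEx 2 CTop)))).

(** Kept apart from the axiom on the input, so that its code is a constant. *)
Definition fixed_tbox : tbox :=
  [:: (CTop, progress); (CTop, CName 0); (CTop, CName 1); (CTop, CName 2)].

Definition input_tbox (n : nat) : tbox := (CTop, CEx 3 (chain n)) :: fixed_tbox.

Definition terminates (M : cprog) (n : nat) : Prop :=
  exists k, size M <= (iter k (cstep M) (cinit n)).1.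

(** * Correctness of the reduction *)

Section Reduction.
Variables (M : cprog) (n : nat).
Let K := width M.
Let run (i : nat) : cconf := iter i (cstep M) (cinit n).
Let c (i : nat) : seq nat := blocks K (run i).

Lemma input_block i : i <= K -> nth 0 (c 0) i = if i == 1 then n else 0.
Proof.
by case: i => [|i] // iK; rewrite /c nth_blocksS.
Qed.

Section Countermodel.
Hypothesis nonterminating : ~ terminates M n.
Let I := unfolding n c.

Lemma unfolding_chain : cext I (chain n) (0, [:: n]).
Proof.
rewrite /chain; elim: n => [|m IH] /=; last by exists (0, [:: m]).
by exists (0, [::]); split=> //; exists (1, c 0).
Qed.

Lemma unfolding_model : is_model I (input_tbox n).
Proof.
move=> g; rewrite !inE => /orP[/eqP ->|/or4P[] /eqP -> //] x _ /=.
- by exists (0, [:: n]); split=> //; apply: unfolding_chain.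
- move=> [n0 [n1 n2]]; case: x n0 n1 n2 => [i [|[|v] s]] n0 n1 n2.
  + by apply: n2; exists (i.+1, c i).
  + by apply: n1; exists (i, s).
  + by apply: n0; exists (i, v :: s).
Qed.

Lemma unfolding_target h i j p : p \in mismatches -> j <= K ->
  acc I (target_pattern j p) h (i, [::]) -> h <> nth 0 (c i) j.
Proof.
move=> pin jK A hE; case: (acc_go A) => {A} y -> A.
have [|m /fits_skipE -> {}A] := unfolding_specs _ A.
  by rewrite size_nseq size_blocks ltnW.
move: A; rewrite addn0 size_nseq (drop_nth 0) ?size_blocks //.
by rewrite hE; apply: unfolding_mismatch.
Qed.

Lemma unfolding_rejects p x : p \in machine_patterns M -> ~ acc I p 0 x.
Proof.
rewrite mem_machine_patterns => /or4P[/eqP->|||].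
- move=> A; case: (acc_go A) => {A} y -> A.
  have [i {}A] := unfolding_any A.
  rewrite -(cats0 (nseq _ _)) in A; have [le _] := unfolding_marks A.
  by apply: nonterminating; exists i.
- case/mapP=> e eE -> A; case: (acc_go A) => {A} y -> A.
  have [i {}A] := unfolding_any A.
  have [|m _ {}A] := unfolding_specs _ A; first by rewrite size_nseq size_blocks.
  move: A; rewrite size_nseq drop_oversize ?size_blocks // => A; case: (acc_go A) => z.
  by move: eE; rewrite !inE => /orP[] /eqP ->.
- case/allpairsP=> [[i p'] [iin pin ->]] A; case: (acc_go A) => {A} y -> A.
  have iK : i <= K by move: iin; rewrite mem_iota.
  have [m [_ mE] {}A] := unfolding_spec A.
  apply: (unfolding_target pin iK A); rewrite input_block // mE.
  by case: eqP => //; rewrite subn0.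
- case/allpairsP=> [[[t i] p'] [tin pin ->]] A; case: (acc_go A) => {A} y -> A.
  move: tin A => /allpairsP[[t' i'] [/flattenP[s /mapP[q]]]].
  rewrite !mem_iota => /= qM -> tin iK [-> ->] A.
  (* The run is at [(j.+1, c j)]; the role 2 after these blocks opens [c j.+1], whose block [i'] is
     what the specs pushed. *)
  have [j {}A] := unfolding_any A.
  have sz : size (transition_specs K t' i') = size (c j).
    by rewrite size_blocks /transition_specs -cat1s size_cat size_map size_iota.
  have [|m] := unfolding_specs _ A; rewrite sz // take_size drop_size => F {}A.
  have [ap mE] := fits_transitionE (run j.+1) (treg_width qM tin) iK F.
  exact: (unfolding_target pin iK A (mE (transitions_sound qM tin ap))).
Qed.

Lemma nonterminating_not_entails : ~ entails (input_tbox n) (machine_vpa M).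
Proof.
move=> en; have := en _ I (inhabits (0, [::])) unfolding_model.
by case/satisfies_acc=> p pin [x A]; apply: unfolding_rejects A.
Qed.

End Countermodel.

Section Entailment.
Variables (D : Type) (I : interp D).
Hypothesis model : is_model I (input_tbox n).

Lemma model_tests A x : A < 3 -> cint I A x.
Proof.
case: A => [|[|[|//]]] _.
- by apply: (model (g := (CTop, CName 0))); rewrite ?inE ?eqxx ?orbT.
- by apply: (model (g := (CTop, CName 1))); rewrite ?inE ?eqxx ?orbT.
- by apply: (model (g := (CTop, CName 2))); rewrite ?inE ?eqxx ?orbT.
Qed.

Lemma model_total x : exists2 e, e < 3 & exists y, rint I e x y.
Proof.
have: cext I progress x.
  by apply: (model (g := (CTop, progress))); rewrite ?inE ?eqxx ?orbT.
move=> /= N; apply: NNPP => no; apply: N; split; last split.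
- by case=> y [r _]; apply: no; exists 0 => //; exists y.
- by case=> y [r _]; apply: no; exists 1 => //; exists y.
- by case=> y [r _]; apply: no; exists 2 => //; exists y.
Qed.

Lemma model_input x : exists x1 x2 x3, [/\ rint I 3 x x1, reads I [:: n] x1 x2 & rint I 2 x2 x3].
Proof.
have: cext I (CEx 3 (chain n)) x by apply: (model (g := (CTop, CEx 3 (chain n)))); rewrite ?mem_head.
case=> x1 [r ch]; exists x1.
have: exists y z z', [/\ marks I n x1 y, rint I 1 y z & rint I 2 z z'].
  elim: n x1 ch {r} => [|m IH] x1 /=; first by case=> z [r1 [z' [r2 _]]]; exists x1, z, z'.
  case=> u [r /IH[y [z [z' [mu r1 r2]]]]]; exists y, z, z'; split=> //.
  by exists u.
by case=> y [z [z' [my r1 r2]]]; exists z, z'; split=> //; exists y, z.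
Qed.

Variable x0 : D.
Hypothesis rejects : forall p, p \in machine_patterns M -> ~ acc I p 0 x0.

(** Being reached from [x0] by role 3 and then the loop of [anywhere], expressed by acceptance so
    that any continuation can be appended. *)
Definition reachable (y : D) : Prop := forall q, acc I (anywhere :: q) 0 y -> acc I (enter :: anywhere :: q) 0 x0.

Lemma reachable_step e x y : e < 3 -> reachable x -> rint I e x y -> reachable y.
Proof.
move=> e3 rx r q A; apply: rx; apply: (acc_loop (h1 := 0) (x1 := x) _ _ r A) => //.
by case: e e3 {r} => [|[|[|]]].
Qed.

Lemma reachable_reads vs x y : reachable x -> reads I vs x y -> reachable y.
Proof.
elim: vs x => [|v vs IH] x rx /=; first by move=> <-.
case=> z [z' [mz r rd]]; apply: IH rd.
suff rz : reachable z by apply: reachable_step r.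
elim: v x rx mz => [|v IHv] x rx /=; first by move=> <-.
by case=> u ru; apply: IHv; apply: reachable_step ru.
Qed.

Definition at_config (i : nat) : Prop :=
  exists x y z, [/\ reachable x, rint I 2 x y & reads I (c i) y z].

Lemma acc_target i j p y z : rint I 2 y z ->
  acc I (specs_pattern (nseq j skip_spec) ++ p) (nth 0 (c i) j) z ->
  acc I (target_pattern j p) (nth 0 (c i) j) y.
Proof. by move=> r A; apply: acc_exit A; split. Qed.

(** The model may branch; a single path is followed, and a wrong block on it would make an input
    pattern accept at [x0]. *)
Lemma at_config0 : at_config 0.
Proof.
have [x1 [x2 [x3 [r3 rd r2]]]] := model_input x0.
have rx1 : reachable x1 by move=> q A; apply: acc_exit A; split.
have sz : K.+1 <= size (c 0) by rewrite size_blocks.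
have [[j [p [jK pin A]]]|[y]] := blocks_exist model_total x3 sz; last first.
  by rewrite take_oversize ?size_blocks // => ry; exists x2, x3, y; split=> //; apply: reachable_reads rd.
exfalso; apply: (rejects (p := enter :: spec_pattern (input_spec j) ++ target_pattern j p)).
  rewrite mem_machine_patterns; apply/or4P; apply: Or43; apply/allpairsP.
  by exists (j, p); rewrite mem_iota.
case: rd => [z [z' [mz r /= z'E]]]; subst z'.
apply: (acc_exit (h1 := 0) (x1 := x1)) => //.
apply: (acc_spec (s := input_spec j) (m := if j == 1 then n else 0) _ mz r); first by rewrite /= subn0.
by rewrite add0n -input_block //; apply: acc_target A.
Qed.

(** Leaving the last block by role 0 or 1 is caught by an end pattern, a wrong block of the next
    configuration by the step pattern of a transition that applies. *)
Lemma at_config_step i : (run i).1 < size M -> at_config i -> at_config i.+1.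
Proof.
move=> iM [x [y [z [rx r2 rd]]]].
have acc_here q : acc I q 0 y -> acc I (enter :: anywhere :: q) 0 x0.
  by move=> A; apply: rx; apply: (acc_exit (h1 := 0) (x1 := y)).
have skips : fits (nseq K.+1 skip_spec) (c i) 0 by have := fits_skip (c i); rewrite size_blocks.
have [e e3 [z' r]] := model_total z.
case: e e3 r => [|[|[|//]]] _ r.
- exfalso; apply: (rejects (p := enter :: anywhere :: specs_pattern (nseq K.+1 skip_spec) ++ [:: (ASkip, [::], AGo 0)])).
    by rewrite mem_machine_patterns; apply/or4P; apply: Or42; apply/mapP; exists 0.
  apply: acc_here; apply: acc_specs skips rd _.
  by apply: (acc_exit (h1 := 0) (x1 := z')) => //; apply: acc_nil.
- exfalso; apply: (rejects (p := enter :: anywhere :: specs_pattern (nseq K.+1 skip_spec) ++ [:: (ASkip, [::], AGo 1)])).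
    by rewrite mem_machine_patterns; apply/or4P; apply: Or42; apply/mapP; exists 1.
  apply: acc_here; apply: acc_specs skips rd _.
  by apply: (acc_exit (h1 := 0) (x1 := z')) => //; apply: acc_nil.
have sz : K.+1 <= size (c i.+1) by rewrite size_blocks.
have [[j [p [jK pin A]]]|[y']] := blocks_exist model_total z' sz; last first.
  rewrite take_oversize ?size_blocks // => ry; exists z, z', y'; split=> //.
  by apply: reachable_reads rd; apply: reachable_step r2.
have [t tin ap] := transitions_complete iM.
exfalso; apply: (rejects (p := enter :: anywhere :: specs_pattern (transition_specs K t j) ++ target_pattern j p)).
  rewrite mem_machine_patterns; apply/or4P; apply: Or44; apply/allpairsP.
  exists ((t, j), p); split=> //; apply/allpairsP; exists (t, j); split=> //; last by rewrite mem_iota.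
  by apply/flattenP; exists (transitions M (run i).1) => //; apply: map_f; rewrite mem_iota.
have F := fits_transition (K := K) (i := j) jK ap (transitions_sound iM tin ap).
apply: acc_here; apply: acc_specs F rd _.
exact: acc_target r A.
Qed.

Lemma not_terminates : ~ terminates M n.
Proof.
(* The induction hypothesis says that no earlier configuration is halting, so the simulation can be
   carried up to [k]. *)
case=> k; elim/ltn_ind: k => k IH halt.
have at_k : at_config k.
  elim: k IH {halt} => [|k IHk] IH; first exact: at_config0.
  apply: at_config_step; first by rewrite ltnNge; apply/negP; apply: IH.
  by apply: IHk => j jk; apply: (IH j); apply: ltnW.
case: at_k => x [y [z [rx r2 [z1 [z2 [mz _ _]]]]]].
apply: (rejects (p := halt_pattern M)); first exact: mem_head.
apply: rx; apply: (acc_exit (h1 := 0) (x1 := y)) => //.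
have {}mz : marks I (size M + ((run k).1 - size M)) y z1 by rewrite subnKC.
have [u mu _] := marks_add mz.
by rewrite -(cats0 (nseq _ _)); apply: acc_marks mu _; apply: acc_nil.
Qed.

End Entailment.

Lemma entails_terminates : entails (input_tbox n) (machine_vpa M) <-> terminates M n.
Proof.
split=> [en|ter D I [x0] model].
- by apply: NNPP => non; apply: nonterminating_not_entails en.
- apply: NNPP => no; apply: (not_terminates model (x0 := x0)) ter => p pin A.
  by apply: no; apply: acc_satisfies pin A => B x; apply: model_tests.
Qed.

End Reduction.

(** * Computing the code of an instance *)

(** The code of a list with head [a] and tail of code [m] in the coding behind [pickle]. *)
Definition push (a m : nat) : nat := 2 ^ a * m.*2.+1.

Definition token (a : nat + nat) : nat := pickle a.

Lemma pickle_pair (S T : countType) (x : S) (y : T) :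
  pickle (x, y) = push (pickle x) (push (pickle y) 0).
Proof. by []. Qed.

Lemma pickle_cons (T : countType) (x : T) (s : seq T) :
  pickle (x :: s) = push (pickle x) (pickle s).
Proof. by []. Qed.

Lemma pickle_concept C :
  pickle C = foldr push 0 [seq token a | a <- GenTree.encode (concept_enc C)].
Proof. by []. Qed.

Lemma encode_ex p C : GenTree.encode (concept_enc (CEx p C)) =
  [:: inl 5, inr p & rcons (GenTree.encode (concept_enc C)) (inl 0)].
Proof. by rewrite /= cats0. Qed.

(** An existential is coded as [inl 5], its role, its argument and a closing [inl 0]. The closing
    tokens gather at the end: one for the top concept, one for each of the roles 2, 1, 3, and [n]
    for role 0. With [tok] and [f] variables, no code is evaluated. *)
Lemma foldr_encode_input (tok : nat + nat -> nat) (f : nat -> nat -> nat) n :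
  let E := f (tok (inl 5)) in
  let r p := f (tok (inr p)) in
  let Z := f (tok (inl 0)) in
  foldr f 0 [seq tok a | a <- GenTree.encode (concept_enc (CEx 3 (chain n)))] =
  E (r 3 (iter n (fun m => E (r 0 m))
    (E (r 1 (E (r 2 (f (tok (inl 1)) (iter n Z (Z (Z (Z (Z 0)))))))))))).
Proof.
move=> E r Z; rewrite encode_ex /= map_rcons foldr_rcons -/Z.
congr (E (r 3 _)); move: (Z 0) => z; rewrite /chain.
elim: n z => [|n IH] z //.
rewrite [iter n.+1 (CEx 0) _]/= encode_ex /= map_rcons foldr_rcons -/Z IH.
by rewrite -iterSr.
Qed.

(** * Loop programs and their compilation to counter machines *)

(* Programs act on the list of register contents, missing entries being 0. *)
Inductive wprog : Type :=
| WSkip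
| WInc of nat
| WSeq of wprog & wprog
| WLoop of nat & wprog.

Inductive exec : wprog -> seq nat -> seq nat -> Prop :=
| exec_skip s : exec WSkip s s
| exec_inc r s : exec (WInc r) s (set_nth 0 s r (nth 0 s r).+1)
| exec_seq a b s1 s2 s3 : exec a s1 s2 -> exec b s2 s3 -> exec (WSeq a b) s1 s3
| exec_loop0 r b s : nth 0 s r = 0 -> exec (WLoop r b) s s
| exec_loopS r b s m s1 s2 : nth 0 s r = m.+1 -> exec b (set_nth 0 s r m) s1 ->
    exec (WLoop r b) s1 s2 -> exec (WLoop r b) s s2.

Fixpoint wsize (w : wprog) : nat :=
  match w with
  | WSkip => 0
  | WInc _ => 1
  | WSeq a b => wsize a + wsize b
  | WLoop _ b => (wsize b).+2
  end.

(* Register [z] stays 0, so that [CDec z o] is an unconditional jump. *)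
Fixpoint compile (z o : nat) (w : wprog) : cprog :=
  match w with
  | WSkip => [::]
  | WInc r => [:: CInc r]
  | WSeq a b => compile z o a ++ compile z (o + wsize a) b
  | WLoop r b => CDec r (o + wsize b).+2 :: compile z o.+1 b ++ [:: CDec z o]
  end.

Lemma size_compile z o w : size (compile z o w) = wsize w.
Proof.
elim: w o => [||a IHa b IHb|r b IH] o //=; first by rewrite size_cat IHa IHb.
by rewrite size_cat IH addn1.
Qed.

Fixpoint avoids (z : nat) (w : wprog) : bool :=
  match w with
  | WSkip => true
  | WInc r => r != z
  | WSeq a b => avoids z a && avoids z b
  | WLoop r b => (r != z) && avoids z b
  end.

Lemma cupd_nth s r v : cupd (nth 0 s) r v = nth 0 (set_nth 0 s r v).
Proof. by apply: functional_extensionality => i; rewrite nth_set_nth. Qed.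

Lemma exec_avoids z w s s' : exec w s s' -> avoids z w -> nth 0 s' z = nth 0 s z.
Proof.
elim=> {w s s'} //=.
- by move=> r s rz; rewrite nth_set_nth /= eq_sym (negPf rz).
- by move=> a b s1 s2 s3 _ IHa _ IHb /andP[/IHa <- /IHb].
- move=> r b s m s1 s2 _ _ IH1 _ IH2 /andP[rz az].
  rewrite IH2 ?rz //= IH1 // nth_set_nth /= eq_sym (negPf rz) //.
Qed.

Definition reach (P : cprog) (x y : cconf) : Prop := exists k, iter k (cstep P) x = y.

Lemma reach_refl P x : reach P x x.
Proof. by exists 0. Qed.

Lemma reach_step P x : reach P x (cstep P x).
Proof. by exists 1. Qed.

Lemma reach_trans P x y z : reach P x y -> reach P y z -> reach P x z.
Proof. by move=> [k <-] [j <-]; exists (j + k); rewrite iterD. Qed.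

Lemma cstep_mid A i B R : cstep (A ++ i :: B) (size A, R) =
  match i with
  | CInc r => ((size A).+1, cupd R r (R r).+1)
  | CDec r j => if R r == 0 then (j, R) else ((size A).+1, cupd R r (R r).-1)
  end.
Proof. by rewrite /= size_cat /= addnS ltnS leq_addr nth_cat ltnn subnn. Qed.

(** Stated inside arbitrary code [A], [B], since the induction meets each subprogram surrounded by
    the rest. *)
Lemma exec_compile z w s s' : exec w s s' -> avoids z w -> nth 0 s z = 0 ->
  forall A B, reach (A ++ compile z (size A) w ++ B)
    (size A, nth 0 s) (size A + wsize w, nth 0 s').
Proof.
elim=> {w s s'} /=.
- by move=> s _ _ A B; rewrite addn0; apply: reach_refl.
- move=> r s _ _ A B; have := reach_step (A ++ CInc r :: B) (size A, nth 0 s).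
  by rewrite cstep_mid cupd_nth addn1.
- move=> a b s1 s2 s3 ea IHa eb IHb /andP[za zb] z0 A B.
  rewrite addnA; apply: (@reach_trans _ _ (size A + wsize a, nth 0 s2)).
    by rewrite -catA; apply: IHa.
  have := IHb zb _ (A ++ compile z (size A) a) B.
  rewrite size_cat size_compile -!catA; apply.
  by rewrite (exec_avoids ea za).
- move=> r b s s0 _ _ A B.
  have := reach_step (A ++ CDec r (size A + wsize b).+2 :: (compile z (size A).+1 b ++ [:: CDec z (size A)]) ++ B) (size A, nth 0 s).
  by rewrite cstep_mid s0 eqxx !addnS.
- move=> r b s m s1 s2 sm eb IHb el IHl /andP[rz zb] z0 A B.
  set P := A ++ _.
  have z1 : nth 0 (set_nth 0 s r m) z = 0 by rewrite nth_set_nth /= eq_sym (negPf rz).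
  apply: (@reach_trans _ _ ((size A).+1, nth 0 (set_nth 0 s r m))).
    have := reach_step P (size A, nth 0 s).
    by rewrite cstep_mid sm /= cupd_nth.
  apply: (@reach_trans _ _ ((size A).+1 + wsize b, nth 0 s1)).
    have := IHb zb z1 (rcons A (CDec r (size A + wsize b).+2)) (CDec z (size A) :: B).
    by rewrite size_rcons cat_rcons /P -catA.
  apply: (@reach_trans _ _ (size A, nth 0 s1)); last by apply: IHl; rewrite ?rz // (exec_avoids eb zb).
  set A' := A ++ CDec r (size A + wsize b).+2 :: compile z (size A).+1 b.
  have PE : P = A' ++ CDec z (size A) :: B by rewrite /P /A' /= -!catA.
  have sA : size A' = (size A).+1 + wsize b by rewrite size_cat /= size_compile addnS.
  have := reach_step P (size A', nth 0 s1).
  by rewrite {2}PE cstep_mid sA (exec_avoids eb zb) z1 eqxx.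
Qed.

Definition wseq (ws : seq wprog) : wprog := foldr WSeq WSkip ws.

Arguments wseq : simpl never.

Lemma exec_cons a ws s1 s2 s3 : exec a s1 s2 -> exec (wseq ws) s2 s3 -> exec (wseq (a :: ws)) s1 s3.
Proof. exact: exec_seq. Qed.

(* Register 3 is an accumulator; 4 is 0 between the steps. *)
Definition wdouble : wprog :=
  wseq [:: WLoop 3 (wseq [:: WInc 4; WInc 4]); WLoop 4 (WInc 3)].

Lemma exec_double u x y m w : exec wdouble [:: u; x; y; m; 0; w] [:: u; x; y; m.*2; 0; w].
Proof.
have up k t : exec (WLoop 3 (wseq [:: WInc 4; WInc 4]))
    [:: u; x; y; k; t; w] [:: u; x; y; 0; k.*2 + t; w].
  elim: k t => [|k IH] t; first exact: exec_loop0.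
  apply: (exec_loopS (m := k)) => //=.
    by apply: exec_cons; [apply: exec_inc | apply: exec_cons; [apply: exec_inc | apply: exec_skip]].
  by have := IH t.+2; rewrite doubleS !addnS !addSn.
have down k t : exec (WLoop 4 (WInc 3)) [:: u; x; y; t; k; w] [:: u; x; y; k + t; 0; w].
  elim: k t => [|k IH] t; first exact: exec_loop0.
  by apply: (exec_loopS (m := k)) => //=; [apply: exec_inc | rewrite addSnnS; apply: IH].
rewrite /wdouble; apply: exec_cons (up _ _) _; apply: exec_cons; last exact: exec_skip.
by have := down m.*2 0; rewrite !addn0.
Qed.

Definition wpush (a : nat) : wprog :=
  wseq [:: wdouble; WInc 3; wseq (nseq a wdouble)].

Lemma exec_push a u x y m w : exec (wpush a) [:: u; x; y; m; 0; w] [:: u; x; y; push a m; 0; w].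
Proof.
rewrite /wpush; apply: exec_cons (exec_double _ _ _ _ _) _; apply: exec_cons (exec_inc _ _) _ => /=.
apply: exec_cons; last exact: exec_skip.
rewrite /push.
elim: a (m.*2.+1) => [|a IH] k; first by rewrite mul1n; apply: exec_skip.
apply: exec_cons (exec_double _ _ _ _ _) _.
by rewrite expnSr -mulnA mul2n; apply: IH.
Qed.

Definition wpush_reg : wprog := wseq [:: wdouble; WInc 3; WLoop 5 wdouble].

Lemma exec_push_reg u x y m w :
  exec wpush_reg [:: u; x; y; m; 0; w] [:: u; x; y; push w m; 0; 0].
Proof.
rewrite /wpush_reg; apply: exec_cons (exec_double _ _ _ _ _) _; apply: exec_cons (exec_inc _ _) _ => /=.
apply: exec_cons; last exact: exec_skip.
rewrite /push.
elim: w (m.*2.+1) => [|w IH] k; first by rewrite mul1n; apply: exec_loop0.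
apply: (exec_loopS (m := w)) => //=; first exact: exec_double.
by rewrite expnSr -mulnA mul2n; apply: IH.
Qed.

Lemma exec_add a u x y m t w :
  exec (wseq (nseq a (WInc 3))) [:: u; x; y; m; t; w] [:: u; x; y; a + m; t; w].
Proof.
elim: a m => [|a IH] m; first exact: exec_skip.
by apply: exec_cons (exec_inc _ _) _; rewrite addSnnS; apply: IH.
Qed.

Lemma exec_move i j s : i != j -> i < size s -> j < size s ->
  exec (WLoop i (WInc j)) s (set_nth 0 (set_nth 0 s j (nth 0 s i + nth 0 s j)) i 0).
Proof.
move=> ij; move E: (nth 0 s i) => k; elim: k s E => [|k IH] s E si sj.
  rewrite [X in exec _ _ X](_ : _ = s); first exact: exec_loop0.
  apply: (eq_from_nth (x0 := 0)); rewrite !size_set_nth; first by lia.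
  move=> l _; rewrite !nth_set_nth /= add0n; case: eqP => [->|_]; first by rewrite E.
  by rewrite !nth_set_nth /=; case: eqP => [->|].
apply: (exec_loopS E (exec_inc _ _)).
set s2 := set_nth _ _ j _.
have ji : (j == i) = false by rewrite eq_sym (negPf ij).
have := IH s2; rewrite /s2 !nth_set_nth /= !nth_set_nth /= !size_set_nth eqxx (negPf ij) ji eqxx.
move=> /(_ erefl); rewrite !leq_max si sj ?orbT => /(_ isT isT).
congr exec; apply: (eq_from_nth (x0 := 0)); rewrite !size_set_nth; first by lia.
move=> l _; do 4!rewrite ?nth_set_nth /=.
by case: (l == i); case: (l == j); rewrite // addSnnS.
Qed.

(** * A program that computes the code of an instance *)

Section Instances.
Variables (top consts : nat) (tok : nat + nat -> nat).

Definition concept_code (n : nat) : nat :=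
  let E := push (tok (inl 5)) in
  let r p := push (tok (inr p)) in
  let Z := push (tok (inl 0)) in
  E (r 3 (iter n (fun m => E (r 0 m))
    (E (r 1 (E (r 2 (push (tok (inl 1)) (iter n Z (Z (Z (Z (Z 0)))))))))))).

Definition tbox_code (n : nat) : nat := push (push top (push (concept_code n) 0)) consts.

(** Tokens are pushed from the last to the first. Registers 1 and 2 are copies of [n] that drive the
    two loops of length [n]; register 0 keeps [n] for the second component of the instance. *)
Definition winstance : wprog :=
  let E := wpush (tok (inl 5)) in
  let r p := wpush (tok (inr p)) in
  let Z := wpush (tok (inl 0)) in
  wseq [:: WLoop 0 (wseq [:: WInc 1; WInc 2; WInc 5]); WLoop 5 (WInc 0);
    Z; Z; Z; Z; WLoop 1 Z; wpush (tok (inl 1)); r 2; E; r 1; E;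
    WLoop 2 (wseq [:: r 0; E]); r 3; E;
    WLoop 3 (WInc 5); wpush_reg; wpush top;
    WLoop 3 (WInc 5); wseq (nseq consts (WInc 3)); wpush_reg;
    WLoop 3 (WInc 1); WLoop 0 (WInc 5); wpush_reg;
    WLoop 1 (WInc 5); wpush_reg; WLoop 3 (WInc 0)].

Lemma exec_instance n :
  exec winstance [:: n; 0; 0; 0; 0; 0] [:: push (tbox_code n) (push n 0); 0; 0; 0; 0; 0].
Proof.
have copy k a b c y m : exec (WLoop 0 (wseq [:: WInc 1; WInc 2; WInc 5]))
    [:: k; a; b; y; m; c] [:: 0; k + a; k + b; y; m; k + c].
  elim: k a b c => [|k IH] a b c; first exact: exec_loop0.
  apply: (exec_loopS (m := k)) => //=.
    by do 3!(apply: exec_cons (exec_inc _ _) _); apply: exec_skip.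
  by rewrite !addSnnS; apply: IH.
have loop1 k u y m w : exec (WLoop 1 (wpush (tok (inl 0)))) [:: u; k; y; m; 0; w]
    [:: u; 0; y; iter k (push (tok (inl 0))) m; 0; w].
  elim: k m => [|k IH] m; first exact: exec_loop0.
  apply: (exec_loopS (m := k)) => //; first exact: exec_push.
  by have := IH (push (tok (inl 0)) m); rewrite -iterSr.
pose F m := push (tok (inl 5)) (push (tok (inr 0)) m).
have loop2 k u x m w :
    exec (WLoop 2 (wseq [:: wpush (tok (inr 0)); wpush (tok (inl 5))])) [:: u; x; k; m; 0; w]
      [:: u; x; 0; iter k F m; 0; w].
  elim: k m => [|k IH] m; first exact: exec_loop0.
  apply: (exec_loopS (m := k) (s1 := [:: u; x; k; F m; 0; w])) => //.
    by do 2!(apply: exec_cons (exec_push _ _ _ _ _ _) _); apply: exec_skip.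
  by have := IH (F m); rewrite -iterSr.
rewrite /winstance.
apply: exec_cons (copy _ _ _ _ _ _) _; rewrite !addn0.
apply: exec_cons; first exact: exec_move.
rewrite /= addn0.
do 4!(apply: exec_cons (exec_push _ _ _ _ _ _) _).
apply: exec_cons (loop1 _ _ _ _ _) _.
do 5!(apply: exec_cons (exec_push _ _ _ _ _ _) _).
apply: exec_cons (loop2 _ _ _ _ _) _.
do 2!(apply: exec_cons (exec_push _ _ _ _ _ _) _).
(* The concept is coded; the rest forms the pairs and lists around it. *)
rewrite -[push (tok (inl 5)) _]/(concept_code n).
apply: exec_cons; first exact: exec_move.
rewrite /= addn0.
apply: exec_cons (exec_push_reg _ _ _ _ _) _.
apply: exec_cons (exec_push _ _ _ _ _ _) _.
apply: exec_cons; first exact: exec_move.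
rewrite /= addn0.
apply: exec_cons (exec_add _ _ _ _ _ _ _) _; rewrite addn0.
apply: exec_cons (exec_push_reg _ _ _ _ _) _.
rewrite -[push _ consts]/(tbox_code n).
apply: exec_cons; first exact: exec_move.
rewrite /= addn0.
apply: exec_cons; first exact: exec_move.
rewrite /= addn0.
apply: exec_cons (exec_push_reg _ _ _ _ _) _.
apply: exec_cons; first exact: exec_move.
rewrite /= addn0.
apply: exec_cons (exec_push_reg _ _ _ _ _) _.
apply: exec_cons; first exact: exec_move.
by rewrite /= addn0; apply: exec_skip.
Qed.

(** Register 6 can then serve as the zero register of [compile]. *)
Lemma winstance_avoids : avoids 6 winstance.
Proof.
have many a w : avoids 6 w -> avoids 6 (foldr WSeq WSkip (nseq a w)).
  by move=> zw; elim: a => //= a IH; apply/andP.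
by rewrite /winstance /wpush_reg /wpush /wseq /= !many.
Qed.

End Instances.

(** * Relocation of a program and the diagonal machine *)

Definition shift (o : nat) (P : cprog) : cprog :=
  [seq match i with CInc r => CInc r | CDec r j => CDec r (o + minn j (size P)) end | i <- P].

(** As in [shift], positions are capped at [size P]: however far [P] jumps outside, its copy
    continues right after its last instruction. *)
Definition lift (o : nat) (P : cprog) (x : cconf) : cconf := (o + minn x.1 (size P), x.2).

Lemma cstep_lift A P B x : x.1 < size P ->
  cstep (A ++ shift (size A) P ++ B) (lift (size A) P x) = lift (size A) P (cstep P x).
Proof.
case: x => pc R /= pcP; rewrite /lift /= pcP (minn_idPl (ltnW pcP)).
rewrite !size_cat size_map ltn_add2l (leq_trans pcP) ?leq_addr //.
rewrite nth_cat ltnNge leq_addr /= addKn nth_cat size_map pcP.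
rewrite (nth_map (CInc 0)) //.
have E : (size A + pc).+1 = size A + minn pc.+1 (size P) by rewrite (minn_idPl pcP) addnS.
by case: (nth _ P pc) => [r|r j] /=; rewrite E //; case: ifP.
Qed.

Lemma reach_lift A P B x k :
  reach (A ++ shift (size A) P ++ B) (lift (size A) P x) (lift (size A) P (iter k (cstep P) x)).
Proof.
elim: k => [|k IH]; first exact: reach_refl.
apply: reach_trans IH _; rewrite iterS; set y := iter _ _ _.
have [yP|Py] := ltnP y.1 (size P).
  by rewrite -(@cstep_lift A P B) //; apply: reach_step.
have -> : cstep P y = y by case: y Py => pc R /= Py; rewrite ltnNge Py.
exact: reach_refl.
Qed.

Lemma cstep_halted P x : size P <= x.1 -> cstep P x = x.
Proof. by case: x => pc R /= Px; rewrite ltnNge Px. Qed.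

Lemma iter_fixed P k x : cstep P x = x -> iter k (cstep P) x = x.
Proof. by move=> xE; elim: k => //= k ->. Qed.

(** Halted configurations are fixed, and a fixed configuration leads only to itself. *)
Lemma terminates_reach P n x : reach P (cinit n) x -> cstep P x = x ->
  (terminates P n <-> size P <= x.1).
Proof.
move=> [k <-] fx; split=> [[j hj]|]; last by exists k.
rewrite -(iter_fixed j fx) -iterD addnC iterD iter_fixed //.
exact: cstep_halted.
Qed.

Definition fixed_code : nat := pickle fixed_tbox.

Lemma pickle_chain_tbox n (C : concept) (T : tbox) :
  pickle ((C, CEx 3 (chain n)) :: T) = tbox_code (pickle C) (pickle T) token n.
Proof.
rewrite pickle_cons pickle_pair [pickle (CEx _ _)]pickle_concept foldr_encode_input.
by rewrite /tbox_code /concept_code; move: token (pickle C) (pickle T).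
Qed.

Lemma pickle_instance n (A : vpa) :
  pickle ((input_tbox n, A) : instance) =
  push (tbox_code (pickle CTop) fixed_code token n) (push (pickle A) 0).
Proof. by rewrite pickle_pair /input_tbox pickle_chain_tbox -/fixed_code; move: token (pickle CTop) fixed_code. Qed.

Lemma instance_program : exists2 G, avoids 6 G & forall A : vpa,
  exec G [:: pickle A; 0; 0; 0; 0; 0]
    [:: pickle ((input_tbox (pickle A), A) : instance); 0; 0; 0; 0; 0].
Proof.
exists (winstance (pickle CTop) fixed_code token); first exact: winstance_avoids.
by move=> A; rewrite pickle_instance; apply: exec_instance.
Qed.

Theorem theorem5p14 : ~ entailment_decidable.
Proof.
case=> P dec.
have [G avG exG] := instance_program.
pose g := wsize G.
pose q := g + size P.
(* Halts on answer 0, and loops in the last instruction on answer 1. *)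
pose tail := [:: CDec 0 q.+2; CDec 0 q.+1].
pose A := compile 6 0 G.
pose M := A ++ shift (size A) P ++ tail.
have sA : size A = g by rewrite size_compile.
have sM : size M = q.+2 by rewrite !size_cat size_map sA /= addnA addn2.
(* The diagonal choice: [n] is the code of the query of [M] itself. The existential hides the values
   of [n] and [c] from computation. *)
have [n [c [x [xE Ex exn]]]] : exists n c (x : instance),
    [/\ x = (input_tbox n, machine_vpa M), pickle x = c &
        exec G [:: n; 0; 0; 0; 0; 0] [:: c; 0; 0; 0; 0; 0]].
  exists (pickle (machine_vpa M)); eexists; eexists.
  by split; [reflexivity | reflexivity | exact: exG].
(* The program [G] clears its work registers, so [P] starts exactly on [cinit c]. *)
have start : reach M (cinit n) (lift (size A) P (cinit c)).
  have R0 k : (fun r => if r == 0 then k else 0) = nth 0 [:: k; 0; 0; 0; 0; 0].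
    by apply: functional_extensionality => -[|[|[|[|[|[|r]]]]]] //=; rewrite nth_nil.
  rewrite /lift /cinit /= min0n addn0 !R0 sA.
  by apply: (exec_compile exn avG _ [::]).
have answer m : halts_with P c m -> exists R,
    [/\ R 0 = m & reach M (cinit n) (q, R)].
  case=> j /= [hj Rm]; exists (iter j (cstep P) (cinit c)).2; split=> //.
  apply: reach_trans start _.
  have -> : q = size A + size P by rewrite sA.
  by have := reach_lift A P tail (cinit c) j; rewrite [lift _ _ (iter _ _ _)]/lift (minn_idPr hj).
have step_q R : cstep M (q, R) = if R 0 == 0 then (q.+2, R) else (q.+1, cupd R 0 (R 0).-1).
  have sB : size (A ++ shift (size A) P) = q by rewrite size_cat size_map sA.
  have := cstep_mid (A ++ shift (size A) P) (CDec 0 q.+2) [:: CDec 0 q.+1] R.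
  by rewrite sB -catA.
have loop R : R 0 = 0 -> cstep M (q.+1, R) = (q.+1, R).
  have sB : size (A ++ shift (size A) P ++ [:: CDec 0 q.+2]) = q.+1.
    by rewrite !size_cat size_map sA /= addn1 addnS.
  have := cstep_mid (A ++ shift (size A) P ++ [:: CDec 0 q.+2]) (CDec 0 q.+1) [::] R.
  by rewrite sB -!catA => + R0; rewrite R0.
have [|yes no] := dec x; first by rewrite xE; apply: pattern_vpa_wf.
rewrite Ex xE in yes no.
(* If the entailment holds, [P] answers 1 and [M] loops, although entailment means that [M] halts;
   otherwise [P] answers 0 and [M] halts, which gives the entailment. *)
have [en|nen] := classic (entails (input_tbox n) (machine_vpa M)).
- have [R [R1 rq]] := answer _ (yes en).
  have rl : reach M (cinit n) (q.+1, cupd R 0 0).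
    by apply: reach_trans rq _; have := reach_step M (q, R); rewrite step_q R1.
  have := (entails_terminates M n).1 en.
  by rewrite (terminates_reach rl) ?loop // sM ltnn.
- have [R [R0 rq]] := answer _ (no nen).
  apply: nen; apply/entails_terminates.
  have rh : reach M (cinit n) (q.+2, R).
    by apply: reach_trans rq _; have := reach_step M (q, R); rewrite step_q R0.
  by rewrite (terminates_reach rh) ?cstep_halted ?sM.
Qed.
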